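(* Let $A>1$, $C_2,D_2>0$, take any $L>0$, and let $\epsilon\in(0,1/2)$. Let $m_n>0$ be a sequence with $m_n=o(1)$ (tending to zero arbitrarily slowly), and set $s_2=n^{1/2-\epsilon}$ and $s_1=m_ns_2$. Let $\Theta_0$ be any one of the three sets $\Theta_0^{(1)},\Theta_0^{(2)},\Theta_0^{(3)}$ (weakened excessive-bias sets) defined in the context. Then there do not exist $\beta,\beta'\in(0,1/3)$ and a confidence set $\mathcal C_n(X)\subset\mathbb R^n$ satisfying simultaneously for $i=1,2$ that $$\liminf_{n\to\infty}\ \inf_{\theta_0\in\Theta_0\cap\ell_0[s_i]}P_{\theta_0}(\theta_0\in\mathcal C_n(X))\ge1-\beta,$$ $$\liminf_{n\to\infty}\ \inf_{\theta_0\in\Theta_0\cap\ell_0[s_i]}P_{\theta_0}\big(\mathrm{diam}(\mathcal C_n(X))\le L\,s_i\log(n/s_i)\big)\ge1-\beta'.$$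
   Context: Model: one observes $X=(X_1,\dots,X_n)$ with $X_i=\theta_i+\varepsilon_i$, $\varepsilon_i$ i.i.d. $N(0,1)$; $P_\theta$ is the law of $X$. $\ell_0[s]=\{\theta\in\mathbb R^n: |\{i:\theta_i\ne0\}|\le s\}$. $\mathrm{diam}(\mathcal C)=\sup_{\theta,\theta'\in\mathcal C}\|\theta-\theta'\|^2$, with $\|\cdot\|$ the Euclidean norm. A confidence set is a (measurable) data-dependent subset of $\mathbb R^n$. For $j=1,2,3$, $\Theta_0^{(j)}$ is the set of $\theta_0\in\ell_0[s_2]$ for which there exists an integer $\ell$ with $\log^2 n\le\ell\le s_2$ such that, respectively: $(j=1)$ $\sum_{i:|\theta_{0,i}|<A\sqrt{2\log(n/\ell)}}\theta_{0,i}^2\le m_n^{-1}\ell\log(n/\ell)$ and $|\{i:|\theta_{0,i}|\ge A\sqrt{2\log(n/\ell)}\}|\ge\ell/C_2$; $(j=2)$ $\sum_{i:|\theta_{0,i}|<A\sqrt{2\log(n/\ell)}}\theta_{0,i}^2\le D_2\,\ell\log(n/\ell)$ and $|\{i:|\theta_{0,i}|\ge A\sqrt{2\log(n/\ell)}\}|\ge m_n\ell$; $(j=3)$ $\sum_{i:|\theta_{0,i}|<m_n\sqrt{2\log(n/\ell)}}\theta_{0,i}^2\le D_2\,\ell\log(n/\ell)$ and $|\{i:|\theta_{0,i}|\ge m_n\sqrt{2\log(n/\ell)}\}|\ge\ell/C_2$.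
   Formalization: ''Tending to zero arbitrarily slowly'' is read as: Θ_0∩ℓ_0[s_1] is nonempty for infinitely many n; if m_n decays so fast that this class is eventually empty, the i=1 conditions are void and the claim fails for large L. *)

(* Defs.v *)
From HB Require Import structures.
From mathcomp Require Import all_boot all_order all_algebra.
From mathcomp Require Import all_classical all_reals all_analysis.

Set Implicit Arguments.
Unset Strict Implicit.
Unset Printing Implicit Defensive.

Import Order.TTheory GRing.Theory Num.Theory.
Import numFieldNormedType.Exports.

Local Open Scope classical_set_scope.
Local Open Scope ring_scope.

(* R^n is [n.-tuple R] with the product of the Borel sigma-algebras. *)

Section gaussian_sequence_model.
Context {R : realType}.

(* The library declares [normal_prob] on [measurableTypeR R], which has the same
   measurable sets as [R] but another display; hence the type of the head. *)
Definition consp n (p : measurableTypeR R * n.-tuple R) : n.+1.-tuple R :=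
  [the n.+1.-tuple R of p.1 :: p.2].

Lemma measurable_consp n : measurable_fun setT (@consp n).
Proof. exact: (@measurable_cons _ _ _ R fst n snd). Qed.

HB.instance Definition _ n :=
  isMeasurableFun.Build _ _ _ _ (@consp n) (@measurable_consp n).

(* The product N(0,1) (x) ... (x) N(0,1), i.e. the joint law of n i.i.d.
   standard normal variables. *)
Fixpoint gaussian_noise n : probability (n.-tuple R) R :=
  match n with
  | 0 => \d_([tuple] : 0.-tuple R)
  | m.+1 =>
      distribution (normal_prob (0 : R) (1 : R) \x gaussian_noise m)%E (@consp m)
  end.

Lemma gaussian_noise_box n (B : 'I_n -> set R) :
  (forall i, measurable (B i)) ->
  gaussian_noise n [set x | forall i, B i (tnth x i)] =
  (\prod_(i < n) normal_prob (0 : R) (1 : R) (B i))%E.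
Proof.
elim: n B => [|n IH] B mB.
  rewrite big_ord0 /= diracE mem_set//= => -[].
  by case.
rewrite big_ord_recl -IH; last by move=> i; exact: mB.
rewrite /= /distribution /pushforward.
rewrite (_ : _ @^-1` _ =
  B ord0 `*` [set x : n.-tuple R | forall i, B (lift ord0 i) (tnth x i)]).
  rewrite product_measure1E//; first exact: mB.
  rewrite (_ : [set _ | _] = \bigcap_(i in [set: 'I_n])
    ((fun x : n.-tuple R => tnth x i) @^-1` B (lift ord0 i))).
    apply: fin_bigcap_measurable => // i _.
    rewrite -[X in measurable X]setTI.
    by apply: measurable_tnth => //; exact: mB.
  by apply/seteqP; split => x /= h i; [move=> _; exact: h|exact: h].
apply/seteqP; split => -[a x] /=.
  move=> h; split; first exact: (h ord0).
  by move=> i; have := h (lift ord0 i); rewrite tnthS.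
by move=> [Ba Bx] i; case: (unliftP ord0 i) => [j|] -> //; rewrite tnthS.
Qed.

(* X = theta + eps *)
Definition observation n (theta eps : n.-tuple R) : n.-tuple R :=
  [tuple tnth theta i + tnth eps i | i < n].

Lemma measurable_observation n (theta : n.-tuple R) :
  measurable_fun setT (observation theta).
Proof.
apply/measurable_fun_tnthP => i.
rewrite (_ : _ \o _ = (fun eps => tnth theta i + tnth eps i)); last first.
  by apply/funext => eps /=; rewrite tnth_mktuple.
by apply: measurable_realfun.measurable_funD => //; exact: measurable_tnth.
Qed.

HB.instance Definition _ n (theta : n.-tuple R) :=
  isMeasurableFun.Build _ _ _ _ (observation theta)
    (measurable_observation theta).

Definition law n (theta : n.-tuple R) : probability (n.-tuple R) R :=
  distribution (gaussian_noise n) (observation theta).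

End gaussian_sequence_model.

Section confidence_sets.
Context {R : realType}.

(* The class l_0[s], for a real sparsity level s. *)
Definition sparse n (s : R) : set (n.-tuple R) :=
  [set theta | #|[pred i | tnth theta i != 0]|%:R <= s].

Definition sqdist n (theta theta' : n.-tuple R) : R :=
  \sum_(i < n) (tnth theta i - tnth theta' i) ^+ 2.

(* Squared Euclidean diameter; it is -oo on the empty set. *)
Definition sqdiam n (C : set (n.-tuple R)) : \bar R :=
  ereal_sup [set (sqdist p.1 p.2)%:E | p in C `*` C].

(* Only the events of the statement are required to be measurable. *)
Definition confidence_set n (C : n.-tuple R -> set (n.-tuple R)) : Prop :=
  (forall theta, measurable [set x | C x theta]) /\
  (forall r : R, measurable [set x | (sqdiam (C x) <= r%:E)%E]).

(* The condition shared by the three weakened excessive-bias sets: for some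
   integer l in [log^2 n, s], with t := kappa * sqrt (2 log (n / l)), the
   coordinates below t have energy at most b * l * log (n / l), and at least
   c * l coordinates are at or above t. *)
Definition excessive_bias n (s kappa b c : R) : set (n.-tuple R) :=
  [set theta | sparse s theta /\
    exists l : nat,
      let h : R := ln (n%:R / l%:R) in
      let t : R := kappa * Num.sqrt (2 * h) in
      [/\ ln (n%:R : R) ^+ 2 <= l%:R <= s,
          \sum_(i < n | `|tnth theta i| < t) tnth theta i ^+ 2
            <= b * (l%:R * h)
        & c * l%:R <= #|[pred i | t <= `|tnth theta i|]|%:R]].

Definition excessive_bias1 (A C2 : R) (m s : nat -> R) n : set (n.-tuple R) :=
  excessive_bias (s n) A (m n)^-1 C2^-1.

Definition excessive_bias2 (A D2 : R) (m s : nat -> R) n : set (n.-tuple R) :=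
  excessive_bias (s n) A D2 (m n).

Definition excessive_bias3 (C2 D2 : R) (m s : nat -> R) n : set (n.-tuple R) :=
  excessive_bias (s n) (m n) D2 C2^-1.

Definition s2 (eps : R) (n : nat) : R := n%:R `^ (1 / 2 - eps).

Definition s1 (m : nat -> R) (eps : R) (n : nat) : R := m n * s2 eps n.

End confidence_sets.

(* Main.v *)
(* Suppose such a confidence set exists, and fix n for which the class of
   sparsity s_1 is not empty. Let theta have floor(s_1) huge coordinates and
   zeros elsewhere, and perturb it by setting about kp * s_2 further coordinates
   to sqrt(eps log n), one in each of as many disjoint blocks of about
   n / (2 s_2) coordinates. These perturbations remain in Theta_0 and in l_0[s_2]
   but lie at squared distance of order s_2 log n from theta, which exceeds
   L s_1 log(n / s_1) because s_1 = o(s_2). On the event that C_n covers theta and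
   has the diameter allowed for s_1, no perturbation is covered. On the other
   hand, the likelihood ratio between the uniform mixture of the perturbations
   and theta has second moment ((N - 1 + n^eps) / N)^k, with k blocks of size N,
   which is at most exp(4 n^(-eps)) -> 1; so the complementary event, of
   probability at most beta + beta' + o(1) under theta, has about the same
   probability under the mixture, where it contains the coverage events. Hence
   1 - beta <= beta + beta' + o(1), contradicting beta, beta' < 1/3. *)
Require Import Defs.
From HB Require Import structures.
From mathcomp Require Import all_boot all_order all_algebra.
From mathcomp Require Import ring lra.
From mathcomp Require Import all_classical all_reals all_analysis.
From mathcomp Require Import measurable_realfun.

Set Implicit Arguments.
Unset Strict Implicit.
Unset Printing Implicit Defensive.

Import Order.TTheory GRing.Theory Num.Theory.
Import numFieldNormedType.Exports.

Local Open Scope classical_set_scope.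
Local Open Scope ring_scope.

(** * Gaussian translation formula, in one dimension and then in [n] dimensions *)

Section cameron_martin.
Context {R : realType}.

Lemma lebesgue_measure_shift (w : R) (A : set R) : measurable A ->
  pushforward lebesgue_measure (+%R w : _ -> measurableTypeR R) A =
  lebesgue_measure A.
Proof.
have mw : measurable_fun setT (+%R w : measurableTypeR R -> measurableTypeR R).
  exact: measurable_funD.
move=> mA; apply/esym.
apply: (@lebesgue_measure_unique _ (pushforward lebesgue_measure _)) => //=.
move=> _ [[a b]] _ <-.
rewrite /pushforward (_ : _ @^-1` _ = `]a - w, b - w]%classic).
  rewrite !lebesgue_measure_itv/= !lte_fin ltrD2r.
  by case: ifP => // _; rewrite -!EFinB; congr (_%:E); ring.
by apply/seteqP; split=> x/=; rewrite !in_itv/= ltrBlDl lerBrDl.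
Qed.

Lemma ge0_integral_lebesgue_shift (w : R) (f : measurableTypeR R -> \bar R) :
  measurable_fun setT f -> (forall x, 0 <= f x)%E ->
  (\int[lebesgue_measure]_x f (w + x)%R = \int[lebesgue_measure]_x f x)%E.
Proof.
have mw : measurable_fun setT (+%R w : measurableTypeR R -> measurableTypeR R).
  exact: measurable_funD.
move=> mf f0.
rewrite -(@ge0_integral_pushforward _ _ _ _ _ _ mw lebesgue_measure setT)//.
by apply: eq_measure_integral => A mA _; exact: lebesgue_measure_shift.
Qed.

(** The change of variables produces a Radon-Nikodym derivative; it agrees almost everywhere with
    the Gaussian density because both have the same integral over every measurable set. *)
Lemma ge0_integral_normal_prob (m s : R) (f : measurableTypeR R -> \bar R) :
  measurable_fun setT f -> (forall x, 0 <= f x)%E ->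
  (\int[normal_prob m s]_x f x =
   \int[lebesgue_measure]_x (f x * (normal_pdf m s x)%:E))%E.
Proof.
move=> mf f0.
have mpdf : measurable_fun setT
    (fun x : measurableTypeR R => (normal_pdf m s x)%:E).
  apply/measurable_EFinP.
  exact: measurable_normal_pdf.
have dom := @normal_prob_dominates R m s.
rewrite -(Radon_Nikodym_SigmaFinite.change_of_variables dom)//.
have mRN := measurable_int _ (Radon_Nikodym_SigmaFinite.f_integrable dom).
apply: ae_eq_integral => //; [exact: emeasurable_funM..|].
apply: ae_eqe_mul2l; apply: integral_ae_eq => //.
  exact: Radon_Nikodym_SigmaFinite.f_integrable.
by move=> E _ mE; rewrite -Radon_Nikodym_SigmaFinite.f_integral.
Qed.

(** After translating Lebesgue measure by [- w], only the ratio of the N(w, 1) and N(0, 1) densities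
    remains. *)
Lemma ge0_integral_normal_shift (w : R) (f : measurableTypeR R -> \bar R) :
  measurable_fun setT f -> (forall x, 0 <= f x)%E ->
  (\int[normal_prob (0 : R) (1 : R)]_x f (w + x)%R =
   \int[normal_prob (0 : R) (1 : R)]_x
     (f x * (expR (w * x - w ^+ 2 / 2))%:E))%E.
Proof.
move=> mf f0.
have mw c : measurable_fun setT (+%R c : measurableTypeR R -> measurableTypeR R).
  exact: measurable_funD.
have mpdf : measurable_fun setT
    (fun x : measurableTypeR R => (normal_pdf 0 1 x)%:E).
  apply/measurable_EFinP.
  exact: measurable_normal_pdf.
have mfw : measurable_fun setT (fun x : measurableTypeR R => f (w + x)).
  exact: (measurableT_comp mf (mw w)).
have me : measurable_fun setT
    (fun x : measurableTypeR R => (expR (w * x - w ^+ 2 / 2))%:E).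
  apply/measurable_EFinP; apply: measurableT_comp => //.
  by apply: measurable_funB => //; exact: measurable_realfun.measurable_funM.
rewrite !ge0_integral_normal_prob//; first last.
- by move=> x; rewrite mule_ge0// lee_fin expR_ge0.
- exact: emeasurable_funM.
rewrite -(ge0_integral_lebesgue_shift (- w)); first last.
- by move=> x; rewrite mule_ge0// lee_fin normal_pdf_ge0.
- exact: emeasurable_funM.
apply: eq_integral => x _; rewrite addNKr -muleA -EFinM; congr (_ * _%:E)%E.

rewrite /normal_pdf oner_eq0 mulrCA /normal_fun -expRD; congr (_ * expR _).
by rewrite !subr0 expr1n; field.
Qed.

Definition dotp n (w x : n.-tuple R) : R := \sum_(i < n) tnth w i * tnth x i.

(* The density of N(w, I) with respect to N(0, I). *)
Definition gaussian_tilt n (w x : n.-tuple R) : R :=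
  expR (dotp w x - dotp w w / 2).

Lemma dotp_consp n (p q : measurableTypeR R * n.-tuple R) :
  dotp (consp p) (consp q) = p.1 * q.1 + dotp p.2 q.2.
Proof.
by rewrite /dotp big_ord_recl; congr (_ + _); apply: eq_bigr => i _; rewrite !tnthS.
Qed.

Lemma gaussian_tilt_consp n (p q : measurableTypeR R * n.-tuple R) :
  gaussian_tilt (consp p) (consp q) =
  expR (p.1 * q.1 - p.1 ^+ 2 / 2) * gaussian_tilt p.2 q.2.
Proof. by rewrite /gaussian_tilt -expRD !dotp_consp; congr expR; field. Qed.

Lemma observation_consp n (p q : measurableTypeR R * n.-tuple R) :
  observation (consp p) (consp q) =
  consp ((p.1 + q.1)%R, observation p.2 q.2).
Proof.
apply: eq_from_tnth => i; rewrite tnth_mktuple.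
by case: (unliftP ord0 i) => [j|] ->; rewrite ?tnthS ?tnth_mktuple.
Qed.

Lemma measurable_gaussian_tilt n (w : n.-tuple R) :
  measurable_fun setT (gaussian_tilt w).
Proof.
apply: measurableT_comp => //; apply: measurable_funB => //.
apply: measurable_sum => i; apply: measurable_funM => //.
exact: measurable_tnth.
Qed.

(** The tilt is a product over coordinates, so Tonelli and induction on [n] reduce the claim to
    dimension one. *)
Lemma ge0_integral_gaussian_shift n (w : n.-tuple R) (f : n.-tuple R -> \bar R) :
  measurable_fun setT f -> (forall x, 0 <= f x)%E ->
  (\int[gaussian_noise n]_x f (observation w x) =
   \int[gaussian_noise n]_x (f x * (gaussian_tilt w x)%:E))%E.
Proof.
elim: n w f => [|n IH] w f mf f0.
  have mfw : measurable_fun setT (fun x => f (observation w x)).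
    exact: (measurableT_comp mf (measurable_observation w)).
  have mft : measurable_fun setT (fun x => f x * (gaussian_tilt w x)%:E)%E.
    by apply: emeasurable_funM => //; apply/measurable_EFinP; exact: measurable_gaussian_tilt.
  rewrite /= !integral_dirac// !diracT !mul1e (tuple0 (observation _ _)).
  by rewrite /gaussian_tilt /dotp !big_ord0 mul0r subr0 expR0 mule1.
have [p wE] : exists p : measurableTypeR R * n.-tuple R, w = consp p.
  by exists (thead w, [tuple of behead w]); rewrite [LHS]tuple_eta.
case: p wE => w0 w' ->{w}.
have mc := @measurable_consp R n.
have mfc : measurable_fun setT (f \o @consp R n) by exact: measurableT_comp.
have mfo : measurable_fun setT (fun x => f (observation (consp (w0, w')) x)).
  exact: (measurableT_comp mf (measurable_observation _)).
have mfoc : measurable_fun setT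
    ((fun x => f (observation (consp (w0, w')) x)) \o @consp R n).
  exact: measurableT_comp.
have mtE : measurable_fun setT (fun x => (gaussian_tilt (consp (w0, w')) x)%:E).
  apply/measurable_EFinP; exact: measurable_gaussian_tilt.
have mft : measurable_fun setT
    (fun x => f x * (gaussian_tilt (consp (w0, w')) x)%:E)%E.
  exact: emeasurable_funM.
have mftc : measurable_fun setT
    ((fun x => f x * (gaussian_tilt (consp (w0, w')) x)%:E)%E \o @consp R n).
  exact: measurableT_comp.
have tilt0 m (v y : m.-tuple R) : (0 <= (gaussian_tilt v y)%:E)%E.
  by rewrite lee_fin expR_ge0.
rewrite [gaussian_noise n.+1]/= !ge0_integral_distribution//; last first.
  by move=> x; rewrite /= mule_ge0.
rewrite !fubini_tonelli1//; last 2 first.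
- by move=> x; rewrite /= ?mule_ge0.
- by move=> x; rewrite /= ?mule_ge0.
(* The integrand once induction has shifted the last [n] coordinates; the first coordinate is
   shifted afterwards. *)
pose G (q : measurableTypeR R * n.-tuple R) :=
  (f (consp q) * (gaussian_tilt w' q.2)%:E)%E.
have mG : measurable_fun setT G.
  apply: emeasurable_funM => //; apply/measurable_EFinP.
  exact: (measurableT_comp (measurable_gaussian_tilt w') measurable_snd).
have G0 q : (0 <= G q)%E by rewrite mule_ge0.
transitivity (\int[normal_prob (0 : R) (1 : R)]_a
    fubini_F (gaussian_noise n) G (w0 + a)%R)%E.
  apply: eq_integral => a _; rewrite /fubini_F.
  under eq_integral do rewrite /= observation_consp/=.
  rewrite (IH w' (fun y => f (consp ((w0 + a)%R, y))))//.
  exact: (measurableT_comp mfc (measurable_pair1 _)).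
rewrite ge0_integral_normal_shift//; first last.
- by move=> a; exact: integral_ge0.
- exact: measurable_fun_fubini_tonelli_F.
apply: eq_integral => a _; rewrite /fubini_F -ge0_integralZr//.
- apply: eq_integral => y _.
  by rewrite /G /= gaussian_tilt_consp/= -muleA -EFinM [in RHS]mulrC.
- exact: (measurableT_comp mG (measurable_pair1 _)).
Qed.

End cameron_martin.

(** * Comparison of a uniform mixture of shifted laws with the unshifted law *)

Section mixture.
Context {R : realType}.

Lemma integral_gaussian_tilt n (w : n.-tuple R) :
  (\int[gaussian_noise n]_x (gaussian_tilt w x)%:E = 1)%E.
Proof.
have := @ge0_integral_gaussian_shift R n w (cst 1%E) (measurable_cst _) (fun=> lee01).
under [in RHS]eq_integral do rewrite mul1e.
by move=> <-; rewrite integral_cst//= mul1e probability_setT.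
Qed.

(** Reading the tilt by [v] as a shift by [v] turns the tilt by [w] into itself times
    [expR (dotp w v)], and a tilt integrates to 1. *)
Lemma integral_gaussian_tiltM n (w v : n.-tuple R) :
  (\int[gaussian_noise n]_x (gaussian_tilt w x * gaussian_tilt v x)%:E
   = (expR (dotp w v))%:E)%E.
Proof.
have mw := measurable_gaussian_tilt w.
have := @ge0_integral_gaussian_shift R n v (fun x => (gaussian_tilt w x)%:E).
have -> : (fun x => (gaussian_tilt w x)%:E *
    (gaussian_tilt v x)%:E)%E = (fun x => (gaussian_tilt w x * gaussian_tilt v x)%:E).
  by apply/funext => x; rewrite EFinM.
move=> <-; first last.
- by move=> x; rewrite lee_fin expR_ge0.
- exact/measurable_EFinP.
rewrite (eq_integral (fun x => (expR (dotp w v))%:E * (gaussian_tilt w x)%:E)%E).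
  rewrite ge0_integralZl//; first by rewrite integral_gaussian_tilt mule1.
  - exact/measurable_EFinP.
  - by move=> x _; rewrite lee_fin expR_ge0.
move=> x _; rewrite -EFinM -expRD; congr (expR _)%:E.
rewrite addrA; congr (_ - _); rewrite /dotp -big_split/=.
by apply: eq_bigr => i _; rewrite tnth_mktuple mulrDr.
Qed.

Lemma law_observation n (theta w : n.-tuple R) (B : set (n.-tuple R)) :
  measurable B ->
  law (observation theta w) B =
  (\int[gaussian_noise n]_x (\1_B (observation theta x) * gaussian_tilt w x)%:E)%E.
Proof.
move=> mB.
have mo t : measurable (observation t @^-1` B).
  by rewrite -[X in measurable X]setTI; exact: measurable_observation.
have := @ge0_integral_gaussian_shift R n w
  (fun x => (\1_(observation theta @^-1` B) x)%:E).
under [in RHS]eq_integral do rewrite -EFinM.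
move=> <-; first last.
- by move=> x; rewrite lee_fin.
- by apply/measurable_EFinP; exact: measurable_indic.
transitivity (\int[gaussian_noise n]_x
    (\1_(observation (observation theta w) @^-1` B) x : R)%:E)%E.
  by rewrite integral_indic// setIT.
have oo x : observation (observation theta w) x =
    observation theta (observation w x).
  by apply: eq_from_tnth => i; rewrite !tnth_mktuple addrA.
apply: eq_integral => x _; congr (_%:E); rewrite !indicE; congr (nat_of_bool _)%:R.
by apply/idP/idP => /set_mem/= h; apply/mem_set => /=; rewrite -?oo// oo.
Qed.

(* Integrating, for the likelihood ratio L, the following pointwise inequality
   replaces Cauchy-Schwarz:
   1_B L + L / a <= 1_B + a / 2 + L^2 / (2 a) + 1 / (2 a),
   all of whose terms are nonnegative, so that no integrability is needed. *)
Lemma mixture_le n (F : finType) (theta : n.-tuple R) (w : F -> n.-tuple R)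
    (a : R) (B : set (n.-tuple R)) :
  measurable B -> 0 < a -> (0 < #|F|)%N ->
  \sum_f \sum_g expR (dotp (w f) (w g)) <= (1 + a ^+ 2) * #|F|%:R ^+ 2 ->
  (\sum_f law (observation theta (w f)) B <=
   #|F|%:R%:E * (law theta B + a%:E))%E.
Proof.
move=> mB a0 F0 H2.
set M : R := #|F|%:R; have M0 : 0 < M by rewrite ltr0n.
have mo t : measurable (observation t @^-1` B).
  by rewrite -[X in measurable X]setTI; exact: measurable_observation.
pose one x : R := \1_B (observation theta x).
pose T f x := gaussian_tilt (w f) x.
have mone : measurable_fun setT one.
  apply: measurableT_comp; last exact: measurable_observation.
  exact: measurable_indic.
have mT f : measurable_fun setT (T f) by exact: measurable_gaussian_tilt.
have T0 f x : 0 <= T f x by exact: expR_ge0.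
have one0 x : 0 <= one x by rewrite /one indicE.
(* The pointwise inequality is used multiplied by [M], with the likelihood ratio written as [S / M],
   where [S] is the sum of the tilts; [K] collects its constant terms. *)
pose K := M * a / 2 + M / (2 * a).
have K0 : 0 <= K by rewrite addr_ge0// ?divr_ge0// ?mulr_ge0// ltW.
pose lhs x := ((\sum_f (one x * T f x)%:E) + \sum_f (a^-1 * T f x)%:E)%E.
pose rhs x := ((M * one x)%:E + K%:E +
   \sum_f \sum_g ((2 * a * M)^-1 * (T f x * T g x))%:E)%E.
have aM0 : 0 <= (2 * a * M)^-1 by rewrite invr_ge0 ?mulr_ge0// ltW.
have ai0 : 0 <= a^-1 by rewrite invr_ge0 ltW.
have m1 f : measurable_fun setT (fun x => (one x * T f x)%:E).
  by apply/measurable_EFinP; exact: measurable_funM.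
have m2 f : measurable_fun setT (fun x => (a^-1 * T f x)%:E).
  by apply/measurable_EFinP; exact: measurable_funM.
have m3 f g : measurable_fun setT (fun x => ((2 * a * M)^-1 * (T f x * T g x))%:E).
  apply/measurable_EFinP; apply: measurable_funM => //; exact: measurable_funM.
have m4 : measurable_fun setT (fun x => (M * one x)%:E).
  by apply/measurable_EFinP; exact: measurable_funM.
have lr x : (lhs x <= rhs x)%E.
  rewrite /lhs /rhs; under [X in (_ <= _ + X)%E]eq_bigr do rewrite sumEFin.
  rewrite !sumEFin -!EFinD lee_fin -!mulr_sumr.
  under [X in _ <= _ + X]eq_bigr do rewrite -!mulr_sumr.
  rewrite -mulr_sumr -mulr_suml; set S := \sum_f T f x.
  rewrite /K; have : one x = 0 \/ one x = 1.
    by rewrite /one indicE; case: (_ \in _); [right|left].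
  rewrite -subr_ge0.
  case=> ->.
    (* For both values of the indicator, the difference of the two sides is a sum of squares divided
       by [2 * a * M]. *)
    rewrite (_ : _ - _ = (2 * a * M)^-1 * ((S - M) ^+ 2 + (a * M) ^+ 2)).
      by rewrite mulr_ge0// addr_ge0// sqr_ge0.
    by field; rewrite !gt_eqF.
  rewrite (_ : _ - _ = (2 * a * M)^-1 * (S - M - a * M) ^+ 2).
    by rewrite mulr_ge0// sqr_ge0.
  by field; rewrite !gt_eqF.
have p0 (x : R) : 0 <= x -> (0 <= x%:E)%E by rewrite lee_fin.
have lhsE : (\int[gaussian_noise n]_x lhs x =
    \sum_f law (observation theta (w f)) B + (M / a)%:E)%E.
  rewrite ge0_integralD//; first last.
  - exact: emeasurable_sum.
  - by move=> x _; apply: sume_ge0 => f _; rewrite p0// mulr_ge0.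
  - exact: emeasurable_sum.
  - by move=> x _; apply: sume_ge0 => f _; rewrite p0// mulr_ge0.
  rewrite !ge0_integral_sum//; first last.
  - by move=> f x _; rewrite p0// mulr_ge0.
  - by move=> f x _; rewrite p0// mulr_ge0.
  congr (_ + _)%E.
    by apply: eq_bigr => f _; rewrite law_observation.
  transitivity (\sum_(f : F) a^-1%:E)%E.
    apply: eq_bigr => f _; under eq_integral do rewrite EFinM.
    rewrite ge0_integralZl//; last 2 first.
    - exact/measurable_EFinP.
    - by move=> x _; exact: p0.
    by rewrite integral_gaussian_tilt mule1.
  by rewrite sumEFin sumr_const -mulr_natl.
have rhsE : (\int[gaussian_noise n]_x rhs x = M%:E * law theta B + K%:E +
    ((2 * a * M)^-1 * \sum_f \sum_g expR (dotp (w f) (w g)))%:E)%E.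
  have m5 f : measurable_fun setT
      (fun x => (\sum_g ((2 * a * M)^-1 * (T f x * T g x))%:E)%E).
    exact: emeasurable_sum.
  have p3 f g x : (0 <= ((2 * a * M)^-1 * (T f x * T g x))%:E)%E.
    by rewrite p0// !mulr_ge0.
  have p5 f x : (0 <= \sum_g ((2 * a * M)^-1 * (T f x * T g x))%:E)%E.
    by apply: sume_ge0 => g _.
  have p1 x : (0 <= (M * one x)%:E)%E by rewrite p0// mulr_ge0// ltW.
  rewrite ge0_integralD//; first last.
  - exact: emeasurable_sum.
  - by move=> x _; apply: sume_ge0 => f _.
  - exact: emeasurable_funD.
  - by move=> x _; rewrite adde_ge0// p0.
  rewrite ge0_integralD//.
  congr (_ + _ + _)%E.
  - under eq_integral do rewrite EFinM.
    rewrite ge0_integralZl//; first last.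
    + by rewrite p0// ltW.
    + by move=> x _; exact: p0.
    + exact/measurable_EFinP.
    transitivity (M%:E * \int[gaussian_noise n]_x (\1_(observation theta @^-1` B) x : R)%:E)%E.
      by [].
    by rewrite integral_indic// setIT.
  - by rewrite integral_cst//= probability_setT mule1.
  - rewrite ge0_integral_sum// mulr_sumr -sumEFin; apply: eq_bigr => f _.
    rewrite ge0_integral_sum// mulr_sumr -sumEFin; apply: eq_bigr => g _.
    under eq_integral do rewrite EFinM.
    rewrite ge0_integralZl//; first by rewrite integral_gaussian_tiltM.
    + by apply/measurable_EFinP; exact: measurable_funM.
    + by move=> x _; rewrite p0// mulr_ge0.
have : (\int[gaussian_noise n]_x lhs x <= \int[gaussian_noise n]_x rhs x)%E.
  apply: ge0_le_integral => //.
  - move=> x _; apply: adde_ge0; apply: sume_ge0 => f _; rewrite p0// mulr_ge0//.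
  - by apply: emeasurable_funD; exact: emeasurable_sum.
  - apply: emeasurable_funD; first exact: emeasurable_funD.
    by apply: emeasurable_sum => f; exact: emeasurable_sum.
rewrite lhsE rhsE.
have fl t : law t B = (fine (law t B))%:E.
  by rewrite fineK// fin_num_measure.
under eq_bigr do rewrite fl.
rewrite (fl theta) sumEFin -!EFinM -!EFinD -?EFinM !lee_fin mulrDr.
move: (\sum_f fine _) (fine _) => Q P le.
(* The second-moment hypothesis bounds the quadratic term by [M / (2 * a) + M * a / 2]; adding [K]
   and cancelling [M / a] leaves an error of [M * a]. *)
have H3 : (2 * a * M)^-1 * (\sum_f \sum_g expR (dotp (w f) (w g))) <=
    (2 * a * M)^-1 * ((1 + a ^+ 2) * M ^+ 2) by rewrite ler_wpM2l.
have E : (2 * a * M)^-1 * ((1 + a ^+ 2) * M ^+ 2) = M / (2 * a) + M * a / 2.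
  by field; rewrite !gt_eqF.
have E2 : M / a = M / (2 * a) + M / (2 * a) by field; rewrite !gt_eqF.
rewrite E in H3; rewrite /K E2 in le; lra.
Qed.

End mixture.

(** * Sparse perturbations with one spike per block, and their second moment *)

Section spikes.
Context {R : realType}.

Definition spike n (S : {set 'I_n}) (d : R) : n.-tuple R :=
  [tuple if i \in S then d else 0 | i < n].

Lemma dotp_spike n (S T : {set 'I_n}) (d : R) :
  dotp (spike S d) (spike T d) = d ^+ 2 * #|S :&: T|%:R.
Proof.
rewrite /dotp mulr_natr -sumr_const [RHS]big_mkcond; apply: eq_bigr => i _.
rewrite !tnth_mktuple inE.
by case: (i \in S); case: (i \in T); rewrite /= ?mul0r ?mulr0 ?expr2.
Qed.

Lemma sqdist_observation_spike n (theta : n.-tuple R) (S : {set 'I_n}) (d : R) :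
  sqdist theta (observation theta (spike S d)) = d ^+ 2 * #|S|%:R.
Proof.
rewrite /sqdist mulr_natr -sumr_const [RHS]big_mkcond; apply: eq_bigr => i _.
rewrite !tnth_mktuple opprD addNKr sqrrN.
by case: ifP => //; rewrite expr0n.
Qed.

Variables (k N n : nat) (p : 'I_k * 'I_N -> 'I_n).
Hypothesis p_inj : injective p.

(** The injection [p] lays out [k] disjoint blocks of [N] coordinates, and [f] selects one
    coordinate in each. *)
Definition section_set (f : {ffun 'I_k -> 'I_N}) : {set 'I_n} :=
  [set p (b, f b) | b : 'I_k].

Lemma card_section_set f : #|section_set f| = k.
Proof. by rewrite card_imset ?card_ord// => b c /p_inj[]. Qed.

Lemma card_section_setI (f g : {ffun 'I_k -> 'I_N}) :
  #|section_set f :&: section_set g| = (\sum_b (f b == g b))%N.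
Proof.
rewrite (_ : _ :&: _ = [set p (b, f b) | b : 'I_k in [pred b | f b == g b]]).
  rewrite card_imset; last by move=> b c /p_inj[].
  by rewrite -sum1_card big_mkcond; apply: eq_bigr => b _; rewrite inE; case: eqP.
apply/setP => i; rewrite inE; apply/andP/imsetP => [[]|[b]].
  move=> /imsetP[b _ ->] /imsetP[c _ /p_inj[<- e]].
  by exists b => //; rewrite inE e.
rewrite inE => /eqP e ->; split; apply/imsetP; exists b => //.
by rewrite -e.
Qed.

(** For fixed [f] the sum over [g] factors over the blocks: in each, the index chosen by [f]
    contributes [expR (d ^+ 2)] and the other [N - 1] contribute 1. The bound then follows from 1 +
    y <= exp y. *)
Lemma spike_second_moment (d : R) : (0 < N)%N ->
  \sum_(f : {ffun 'I_k -> 'I_N}) \sum_(g : {ffun 'I_k -> 'I_N})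
    expR (dotp (spike (section_set f) d) (spike (section_set g) d)) <=
  expR (k%:R * expR (d ^+ 2) / N%:R) * #|{ffun 'I_k -> 'I_N}|%:R ^+ 2.
Proof.
move=> N0; have N0' : 0 < N%:R :> R by rewrite ltr0n.
set e := expR (d ^+ 2); have e0 : 0 < e by exact: expR_gt0.
have inner f : \sum_(g : {ffun 'I_k -> 'I_N})
    expR (dotp (spike (section_set f) d) (spike (section_set g) d)) =
    (e + N.-1%:R) ^+ k.
  under eq_bigr => g _.
    rewrite dotp_spike card_section_setI natr_sum mulr_sumr expR_sum.
    over.
  rewrite -(bigA_distr_bigA (fun b j => expR (d ^+ 2 * (f b == j)%:R))).
  rewrite -[in RHS](card_ord k) -prodr_const; apply: eq_bigr => b _.
  rewrite (bigD1 (f b))//= eqxx mulr1; congr (_ + _).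
  rewrite (eq_bigr (fun=> 1)) => [|j]; last first.
    by rewrite eq_sym => /negbTE ->; rewrite mulr0 expR0.
  by rewrite sumr_const cardC1 card_ord.
have key : (e + N.-1%:R) ^+ k <= expR (k%:R * e / N%:R) * N%:R ^+ k.
  rewrite -mulrA expRM_natl -exprMn lerXn2r//.
  - by rewrite nnegrE addr_ge0// ltW.
  - by rewrite nnegrE mulr_ge0// expR_ge0.
  rewrite (@le_trans _ _ ((1 + e / N%:R) * N%:R))//; last first.
    by rewrite ler_wpM2r ?expR_ge1Dx// ltW.
  rewrite mulrDl mul1r divfK ?gt_eqF// addrC lerD2r ler_nat.
  exact: leq_pred.
under eq_bigr do rewrite inner.
rewrite sumr_const card_ffun !card_ord -[X in X <= _]mulr_natr natrX expr2 mulrA.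
by rewrite ler_wpM2r ?exprn_ge0.
Qed.

End spikes.

(** * From an undetectable separated mixture to a constraint on the error levels *)

Section tradeoff.
Context {R : realType}.

Lemma confidence_set_tradeoff n (F : finType) (C : n.-tuple R -> set (n.-tuple R))
    (theta : n.-tuple R) (w : F -> n.-tuple R) (r a b b' : R) :
  confidence_set C -> 0 < a -> (0 < #|F|)%N ->
  \sum_f \sum_g expR (dotp (w f) (w g)) <= (1 + a ^+ 2) * #|F|%:R ^+ 2 ->
  (forall f, r < sqdist theta (observation theta (w f))) ->
  ((1 - b)%:E <= law theta [set x | C x theta])%E ->
  ((1 - b')%:E <= law theta [set x | (sqdiam (C x) <= r%:E)%E])%E ->
  (forall f, (1 - b)%:E <= law (observation theta (w f))
     [set x | C x (observation theta (w f))])%E ->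
  1 <= 2 * b + b' + a.
Proof.
move=> [mC mD] a0 F0 H2 sep hb hb' hf.
set E := [set x | C x theta] in hb; set D := [set x | _] in hb'.
have mE : measurable E by exact: mC.
have {}mD : measurable D by exact: mD.
have mB : measurable (~` (E `&` D)) by apply: measurableC; exact: measurableI.
(* If the set covered a perturbation while covering [theta] with squared diameter at most [r], the
   two points would contradict [sep]. *)
have Ef f : (law (observation theta (w f)) [set x | C x (observation theta (w f))]
    <= law (observation theta (w f)) (~` (E `&` D)))%E.
  apply: (@le_measure _ _ _ (law (observation theta (w f)))); rewrite ?inE//.
  move=> x/= Cf [Ct Dx]; move: (sep f); apply/negP; rewrite -leNgt.
  rewrite -lee_fin; apply: le_trans Dx; apply: ereal_sup_ubound.
  by exists (theta, observation theta (w f)).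
have fl t (A : set (n.-tuple R)) : measurable A -> law t A = (fine (law t A))%:E.
  by move=> mA; rewrite fineK// fin_num_measure.
have hB : (law theta (~` (E `&` D)) <= (b + b')%:E)%E.
  rewrite setCI; apply: (@le_trans _ _ (law theta (~` E) + law theta (~` D))%E).
    by apply: measureU2; exact: measurableC.
  rewrite (probability_setC (law theta) mE) (probability_setC (law theta) mD).
  move: hb hb'; rewrite (fl _ E)// (fl _ D)//.
  by rewrite -!EFinB -EFinD !lee_fin; lra.
have := mixture_le theta mB a0 F0 H2.
have low : ((#|F|%:R * (1 - b))%:E <=
    \sum_f law (observation theta (w f)) (~` (E `&` D)))%E.
  rewrite mulr_natl -sumr_const -sumEFin.
  by apply: lee_sum => f _; exact: le_trans (Ef f).
move=> /(le_trans low); rewrite (fl _ _ mB) -EFinD -EFinM lee_fin.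
rewrite ler_pM2l ?ltr0n//; move: hB; rewrite (fl _ _ mB) lee_fin; lra.
Qed.

End tradeoff.

(** * Construction of the least favorable point and its perturbations at fixed [n] *)

Section construction.
Context {R : realType}.

(** Coordinates in [H] reach the threshold, so only those in [S] can contribute energy below it. The
    final disjunction says that they also reach the threshold, or that their total energy fits the
    budget. *)
Lemma excessive_bias_two_level n (theta : n.-tuple R) (H S : {set 'I_n})
    (l : nat) (s kappa b c M d h t : R) :
  h = ln (n%:R / l%:R) -> t = kappa * Num.sqrt (2 * h) ->
  (forall i, tnth theta i = if i \in H then M else if i \in S then d else 0) ->
  #|H|%:R + #|S|%:R <= s -> ln (n%:R : R) ^+ 2 <= l%:R <= s ->
  c * l%:R <= #|H|%:R -> t <= M ->
  0 <= b * (l%:R * h) -> t <= d \/ #|S|%:R * d ^+ 2 <= b * (l%:R * h) ->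
  excessive_bias s kappa b c theta.
Proof.
move=> hE tE thE HSs ls cl tM blh0 tS; split.
  rewrite /sparse/=; apply: le_trans HSs; rewrite -natrD ler_nat.
  apply: (@leq_trans #|H :|: S|); last by rewrite cardsU leq_subr.
  apply: subset_leq_card; apply/fintype.subsetP => i; rewrite !inE thE.
  by case: (i \in H) => //=; case: (i \in S) => //=; rewrite eqxx.
exists l; rewrite /= -hE -tE; split => //; last first.
  apply: (le_trans cl); rewrite ler_nat; apply: subset_leq_card.
  apply/fintype.subsetP => i iH; rewrite inE thE iH.
  exact: le_trans (ler_norm _).
have small i : `|tnth theta i| < t -> i \notin H.
  by apply: contraTN => iH; rewrite -leNgt thE iH (le_trans tM)// ler_norm.
case: tS => [td|]; last first.
  apply: le_trans; rewrite mulr_natl -sumr_const big_mkcond [leRHS]big_mkcond/=.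
  apply: ler_sum => i _; case: ifPn => [/small iH|_].
    by rewrite thE (negbTE iH); case: ifPn => // _; rewrite expr0n.
  by case: ifPn => // _; rewrite sqr_ge0.
rewrite big1// => i ti; have := small i ti; rewrite thE => /negbTE ->.
case: ifPn => [iS|_]; last by rewrite expr0n.
have /negbTE := small i ti; move: ti; rewrite thE => + iH; rewrite iH iS.
by rewrite ltNge (le_trans td)// ler_norm.
Qed.

(* Here [m * s] and [s] play the roles of [s_1] and [s_2]; the disjunction says
   that the perturbed coordinates either reach the threshold or have total
   energy within the budget [b l log (n / l)], where [l >= m s / (4 c)]. *)
Lemma least_favorable n (s m kappa b c kp d L a : R) :
  0 < c -> 0 < kappa -> 0 <= b -> 0 < m -> 0 < kp -> 0 <= d ->
  1 <= ln (n%:R : R) -> s <= n%:R / 4 -> ln (n%:R : R) / 2 <= ln (n%:R / s) ->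
  m <= 1 / 2 -> kp <= 1 / 2 -> m <= c -> 2 <= kp * s ->
  kappa * Num.sqrt (2 * ln (n%:R : R)) <= d \/
    kp * s * d ^+ 2 <= b * (m * s / (4 * c) * (ln (n%:R : R) / 2)) ->
  L * (m * s) * ln (n%:R / (m * s)) < kp * s / 2 * d ^+ 2 ->
  expR (4 * s ^+ 2 * expR (d ^+ 2) / n%:R) <= 1 + a ^+ 2 ->
  excessive_bias s kappa b c `&` @sparse R n (m * s) !=set0 ->
  exists (theta : n.-tuple R) (F : finType) (w : F -> n.-tuple R),
    [/\ (excessive_bias s kappa b c `&` sparse (m * s)) theta,
        forall f, (excessive_bias s kappa b c `&` sparse s)
                    (observation theta (w f)),
        (0 < #|F|)%N,
        \sum_f \sum_g expR (dotp (w f) (w g)) <= (1 + a ^+ 2) * #|F|%:R ^+ 2 &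
        forall f, L * (m * s) * ln (n%:R / (m * s)) <
                  sqdist theta (observation theta (w f))].
Proof.
move=> c0 kappa0 b0 m0 kp0 d0 lnn sn lns m12 kp12 mc kps cases sep exp4 [th'].
case=> -[_ [l' [/andP[l1 l2] _ l3]]] sp'.
have n0 : 0 < n%:R :> R.
  by rewrite ltNge; apply/negP => n0; move: lnn; rewrite ln0// ler10.
have s0 : 0 < s by have := lt_le_trans (ltr0n R 2) kps; rewrite pmulr_rgt0.
have l'1 : 1 <= l'%:R :> R by apply: le_trans l1; rewrite exprn_ege1.
have l'0 : 0 < l'%:R :> R by exact: lt_le_trans l'1.
have ms0 : 0 < m * s by exact: mulr_gt0.
set q := Num.truncn (m * s).
have qms : q%:R <= m * s by rewrite truncn_le ltW.
(* Since [l'] is at most [s < n], the threshold of the given point [th'] is positive, so its large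
   coordinates are nonzero and number at most [m * s]. *)
have cl'q : c * l'%:R <= q%:R.
  apply: (le_trans l3); rewrite ler_nat.
  rewrite truncn_ge_nat; last exact: ltW.
  move: sp'; rewrite /sparse/=; apply: le_trans.
  rewrite ler_nat; apply: subset_leq_card; apply/fintype.subsetP => i; rewrite !inE.
  apply: contraTN => /eqP ->; rewrite normr0 -ltNge.
  rewrite mulr_gt0// sqrtr_gt0 mulr_gt0// ln_gt0// ltr_pdivlMr// mul1r.
  apply: le_lt_trans l2 _; apply: le_lt_trans sn _.
  by rewrite ltr_pdivrMr// ltr_pMr// ltr1n.
have q1 : 1 <= q%:R :> R.
  rewrite ler1n -(@ltr0n R); apply: lt_le_trans cl'q; exact: mulr_gt0.
have msq : m * s < q%:R + 1 by have := truncnS_gt (m * s); rewrite -natr1.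
have qc0 : 0 <= q%:R / c by rewrite divr_ge0// ltW.
(* The largest integer for which [q] huge coordinates suffice. It inherits the lower bound log^2 n
   from [l'], and stays below [s] because [m <= c]. *)
set l := Num.truncn (q%:R / c).
have lq : l%:R <= q%:R / c by rewrite truncn_le.
have l'l : l'%:R <= l%:R :> R.
  by rewrite ler_nat truncn_ge_nat// ler_pdivlMr// mulrC.
have ql : q%:R / c < l%:R + 1 by have := truncnS_gt (q%:R / c); rewrite -natr1.
have l_1 : 1 <= l%:R :> R by exact: le_trans l'l.
have l_0 : 0 < l%:R :> R by exact: lt_le_trans l_1.
have ls : l%:R <= s.
  apply: (le_trans lq); rewrite ler_pdivrMr//; apply: (le_trans qms).
  by rewrite mulrC ler_wpM2l// ltW.
(* Each of the two roundings loses at most a factor 2, because [q] and [l] are at least 1. *)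
have lms : m * s / (4 * c) <= l%:R.
  have : q%:R / c <= 2 * l%:R by lra.
  rewrite !ler_pdivrMr//; lra.
pose h : R := ln (n%:R / l%:R).
have lnh : ln (n%:R : R) / 2 <= h.
  apply: (le_trans lns); rewrite /h ler_ln ?posrE ?divr_gt0//.
  by rewrite ler_pM2l// lef_pV2.
have hln : h <= ln n%:R.
  by rewrite /h ler_ln ?posrE ?divr_gt0// ler_pdivrMr// ler_peMr// ltW.
have h0 : 0 <= h by lra.
set t := kappa * Num.sqrt (2 * h).
have t0 : 0 <= t by rewrite mulr_ge0 ?sqrtr_ge0// ltW.
set k := Num.truncn (kp * s).
have kps0 : 0 <= kp * s by lra.
have kks : k%:R <= kp * s by rewrite truncn_le.
have kk : kp * s / 2 <= k%:R.
  by have := truncnS_gt (kp * s); rewrite -natr1 -/k; lra.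
have ns0 : 0 <= n%:R / (2 * s) by rewrite divr_ge0 ?mulr_ge0// ltW.
(* With blocks of this size, the [k] blocks use at most n / 4 coordinates and the huge ones at most
   n / 8, so all fit disjointly. *)
set N := Num.truncn (n%:R / (2 * s)).
have Nns : N%:R <= n%:R / (2 * s) by rewrite truncn_le.
have nsN : n%:R / (4 * s) <= N%:R.
  have := truncnS_gt (n%:R / (2 * s)); rewrite -natr1 -/N.
  have : 1 <= n%:R / (4 * s) by rewrite ler_pdivlMr ?mulr_gt0//; lra.
  have -> : n%:R / (2 * s) = n%:R / (4 * s) + n%:R / (4 * s).
    by field; rewrite gt_eqF.
  lra.
have N0 : (0 < N)%N.
  by rewrite -(@ltr0n R) (lt_le_trans _ nsN)// divr_gt0// mulr_gt0.
have qkN : (q + k * N <= n)%N.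
  rewrite -(@ler_nat R) natrD natrM.
  have kN : k%:R * N%:R <= kp * s * (n%:R / (2 * s)) by rewrite ler_pM.
  have E : kp * s * (n%:R / (2 * s)) = kp * (n%:R / 2) by field; rewrite gt_eqF.
  have : kp * (n%:R / 2) <= 1 / 2 * (n%:R / 2) by rewrite ler_wpM2r// ltW// divr_gt0.
  have : m * s <= 1 / 2 * s by rewrite ler_wpM2r// ltW.
  by rewrite E in kN; lra.
(* The first [q] indices are reserved for the huge coordinates; the blocks follow, enumerated by
   rank. *)
have pP (x : 'I_k * 'I_N) : (q + enum_rank x < n)%N.
  apply: leq_trans qkN; rewrite ltn_add2l (leq_trans (ltn_ord _))//.
  by rewrite card_prod !card_ord.
pose p x := Ordinal (pP x).
have p_inj : injective p.
  by move=> x y /(congr1 val)/= /addnI /val_inj /enum_rank_inj.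
have qn : (q <= n)%N by apply: leq_trans qkN; exact: leq_addr.
pose H : {set 'I_n} := [set widen_ord qn i | i : 'I_q].
have cH : #|H| = q by rewrite card_imset ?card_ord// => i j /(congr1 val)/= /val_inj.
have HP i : i \in H -> (i < q)%N by case/imsetP => j _ -> /=; exact: (ltn_ord j).
have SP f i : i \in section_set p f -> i \notin H.
  case/imsetP => j _ ->; apply/negP => /HP /=; rewrite ltnNge leq_addr//.
pose theta := spike H (t + 1) : n.-tuple R.
pose w f := spike (section_set p f) d.
have blh0 : 0 <= b * (l%:R * h) by rewrite !mulr_ge0.
have q_ms : q%:R <= s.
  by apply: (le_trans qms); rewrite ler_piMl ?ltW//; lra.
have lnl : ln (n%:R : R) ^+ 2 <= l%:R <= s by rewrite ls (le_trans l1).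
have clq : c * l%:R <= q%:R by move: lq; rewrite ler_pdivlMr// mulrC.
have tt1 : t <= t + 1 by lra.
exists theta, {ffun 'I_k -> 'I_N}, w; split.
- split.
    apply: (@excessive_bias_two_level _ _ H finset.set0 l _ _ _ _ (t + 1) 0 h t).
    all: rewrite ?cH ?cards0 ?addr0 ?mul0r//.
    2: by right.
    by move=> i; rewrite tnth_mktuple inE.
  rewrite /sparse/=; apply: le_trans qms; rewrite -cH ler_nat.
  apply: subset_leq_card; apply/fintype.subsetP => i; rewrite !inE tnth_mktuple.
  by case: ifP; rewrite ?eqxx.
- move=> f; set th := observation _ _.
  suff EB : excessive_bias s kappa b c th by split => //; case: EB.
  apply: (@excessive_bias_two_level _ _ H (section_set p f) l _ _ _ _ (t + 1) d h t).
  all: rewrite ?cH ?card_section_set//.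
  + move=> i; rewrite !tnth_mktuple; case: ifPn => iH; last by rewrite add0r.
    by case: ifPn => [/SP|]; rewrite ?iH ?addr0.
  + have : m * s <= 1 / 2 * s by rewrite ler_wpM2r// ltW.
    have : kp * s <= 1 / 2 * s by rewrite ler_wpM2r// ltW.
    lra.
  (* The threshold case uses [h <= ln n]; the energy case uses [l >= m s / (4 c)] and
     [h >= ln n / 2]. *)
  + case: cases => [A|B]; [left|right].
      apply: le_trans A; rewrite -/h ler_wpM2l ?(ltW kappa0)// ler_wsqrtr//; lra.
    apply: (@le_trans _ _ (kp * s * d ^+ 2)); first by rewrite ler_wpM2r// sqr_ge0.
    apply: (le_trans B); rewrite ler_wpM2l//; apply: ler_pM => //; last by lra.
    by rewrite divr_ge0// ?mulr_ge0// ltW.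
- by rewrite card_ffun !card_ord expn_gt0 N0.
- apply: (le_trans (spike_second_moment p_inj d N0)).
  rewrite ler_wpM2r ?exprn_ge0//; apply: le_trans exp4; rewrite ler_expR.
  rewrite ler_pdivrMr ?ltr0n//.
  set e := expR _; have e0 : 0 < e by exact: expR_gt0.
  apply: (@le_trans _ _ (s * e)).
    rewrite ler_pM2r// (le_trans kks)//; apply: ler_piMl; [exact: ltW|lra].
  have -> : s * e = 4 * s ^+ 2 * e / n%:R * (n%:R / (4 * s)).
    by field; rewrite !gt_eqF.
  by rewrite ler_wpM2l// !mulr_ge0// ?invr_ge0 ?sqr_ge0// ltW.
- move=> f; rewrite sqdist_observation_spike card_section_set//.
  by apply: (lt_le_trans sep); rewrite mulrC ler_wpM2l// sqr_ge0.
Qed.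

End construction.

(** * Limit inferior and growth estimates for large [n] *)

Section asymptotics.
Context {R : realType}.

Lemma limn_einf_near (u : (\bar R)^nat) (x r : R) :
  (x%:E <= limn_einf u)%E -> r < x ->
  exists N, forall n, (N <= n)%N -> (r%:E <= u n)%E.
Proof.
move=> xu rx; have : (r%:E < limn_einf u)%E by rewrite (lt_le_trans _ xu)// lte_fin.
rewrite limn_einf_lim (cvg_lim _ (@cvg_einfs_sup _ u))// => /ereal_sup_gt[_ [N _ <-]].
move=> rN; exists N => n Nn; apply: (le_trans (ltW rN)).
by apply: ereal_inf_lbound; exists n.
Qed.

Lemma ln_nat_ge (X : R) :
  exists N : nat, forall n, (N <= n)%N -> X <= ln (n%:R : R).
Proof.
exists (Num.truncn (expR X)).+1 => n Nn.
have e0 := expR_gt0 X.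
have en : expR X <= n%:R.
  by rewrite ltW// (lt_le_trans (truncnS_gt _))// ler_nat.
by rewrite -[X in X <= _]expRK ler_ln ?posrE// (lt_le_trans e0).
Qed.

(* With x = ln n, every quantity is an exponential in x or controlled by one,
   and exp y >= 1 + y suffices for all the limits. *)
Lemma calibration (eps L kp a : R) :
  0 < eps < 1 / 2 -> 0 < L -> 0 < kp -> 0 < a ->
  exists X mu : R, 0 < mu /\ forall (n : nat) (m : R),
    X <= ln (n%:R : R) -> 0 < m <= mu ->
    let s := s2 eps n in let d := Num.sqrt (eps * ln n%:R) in
    [/\ 1 <= ln (n%:R : R), s <= n%:R / 4,
        ln (n%:R : R) / 2 <= ln (n%:R / s), 2 <= kp * s &
        L * (m * s) * ln (n%:R / (m * s)) < kp * s / 2 * d ^+ 2 /\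
        expR (4 * s ^+ 2 * expR (d ^+ 2) / n%:R) <= 1 + a ^+ 2].
Proof.
case/andP => e0 e12 L0 kp0 a0.
have a1 : 1 < 1 + a ^+ 2 by rewrite ltrDl exprn_gt0.
have la : 0 < ln (1 + a ^+ 2) by exact: ln_gt0.
have e12' : 0 < 1 / 2 - eps by lra.
have kpe : 0 < kp * eps by exact: mulr_gt0.
(* The summand 6 gives [s <= n / 4]; the next three serve, in order, [2 <= kp * s], the separation
   and the second moment. The bound on [m] makes [L * m] at most [kp * eps / 8]. *)
exists (6 + 2 / (kp * (1 / 2 - eps)) + 4 * L / (kp * eps)
  + 4 / (eps * ln (1 + a ^+ 2))), (kp * eps / (8 * L)).
split; first by rewrite divr_gt0// mulr_gt0.
move=> n m; set x := ln n%:R => Xx /andP[m0 mmu] s d.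
set y1 := 2 / _ in Xx; set y2 := 4 * L / _ in Xx; set y3 := 4 / _ in Xx.
have y10 : 0 <= y1 by rewrite divr_ge0// ltW// mulr_gt0.
have y20 : 0 <= y2 by rewrite divr_ge0// ltW// mulr_gt0.
have y30 : 0 <= y3 by rewrite divr_ge0// ltW// mulr_gt0.
have x6 : 6 <= x by lra.
have n0 : 0 < n%:R :> R.
  by rewrite ltNge; apply/negP => n0; move: x6; rewrite /x ln0//; lra.
have nE : n%:R = expR x by rewrite lnK// posrE.
have sE : s = expR ((1 / 2 - eps) * x) by rewrite /s /s2 /powR gt_eqF.
have s0 : 0 < s by rewrite sE expR_gt0.
have lns : ln s = (1 / 2 - eps) * x by rewrite sE expRK.
have sx : 1 + (1 / 2 - eps) * x <= s by rewrite sE expR_ge1Dx.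
have ex0 : 0 <= eps * x by rewrite mulr_ge0; lra.
have dE : d ^+ 2 = eps * x by rewrite sqr_sqrtr.
split.
- lra.
- rewrite ler_pdivlMr// nE sE.
  rewrite [leRHS](_ : _ = expR ((1 / 2 - eps) * x) * expR ((1 / 2 + eps) * x)).
    2: by rewrite -expRD; congr expR; field.
  rewrite ler_wpM2l ?expR_ge0//.
  apply: le_trans (expR_ge1Dx _); rewrite mulrDl; lra.
- by rewrite ln_div ?posrE// lns -/x; lra.
- have : kp * ((1 / 2 - eps) * x) <= kp * s by rewrite ler_pM2l//; lra.
  have : kp * ((1 / 2 - eps) * y1) = 2.
    by rewrite mulrA mulrC /y1 divfK// gt_eqF// mulr_gt0.
  have : kp * ((1 / 2 - eps) * y1) <= kp * ((1 / 2 - eps) * x).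
    by rewrite !ler_pM2l//; lra.
  lra.
split.
  have ms0 : 0 < m * s by exact: mulr_gt0.
  (* Bounding log(1/m) by 1/m suffices: multiplied by [L * (m * s)] it becomes [L * s], which is
     dominated by a multiple of [s * x]. *)
  have lnE : ln (n%:R / (m * s)) <= x + m^-1.
    rewrite ln_div ?posrE// lnM ?posrE// lns -/x.
    have : ln m^-1 <= m^-1 by rewrite ltW// ln_sublinear// invr_gt0.
    rewrite lnV ?posrE//.
    have : 0 <= (1 / 2 - eps) * x by rewrite mulr_ge0; lra.
    lra.
  have Lms : 0 < L * (m * s) by exact: mulr_gt0.
  apply: (@le_lt_trans _ _ (L * (m * s) * (x + m^-1))); first by rewrite ler_pM2l.
  have -> : L * (m * s) * (x + m^-1) = s * (L * m * x + L).
    by field; rewrite gt_eqF.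
  have -> : kp * s / 2 * d ^+ 2 = s * (kp * eps * x / 2) by rewrite dE; field.
  rewrite ltr_pM2l//.
  have : L * m <= kp * eps / 8.
    rewrite mulrC -ler_pdivlMr//; apply: (le_trans mmu).
    by rewrite le_eqVlt; apply/orP; left; apply/eqP; field; rewrite gt_eqF.
  have y2E : kp * eps * y2 = 4 * L by rewrite /y2; field; rewrite !gt_eqF.
  have : kp * eps * y2 < kp * eps * x by rewrite ltr_pM2l//; lra.
  move=> h1 h2; have : L * m * x <= kp * eps / 8 * x by rewrite ler_wpM2r//; lra.
  lra.
rewrite -[leRHS]lnK ?posrE ?(lt_trans ltr01)// ler_expR dE.
(* Here s^2 = n^(1 - 2 eps), so the exponents add up to [- eps * x]. *)
have -> : 4 * s ^+ 2 * expR (eps * x) / n%:R = 4 / expR (eps * x).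
  rewrite nE sE -expRM_natl -mulrA -mulrA -!expRN -!expRD.
  by congr (_ * expR _); field.
rewrite ler_pdivrMr ?expR_gt0//.
have : ln (1 + a ^+ 2) * (eps * y3) = 4 by rewrite /y3; field; rewrite !gt_eqF.
have : ln (1 + a ^+ 2) * (eps * y3) <= ln (1 + a ^+ 2) * (eps * x).
  by rewrite !ler_pM2l//; lra.
have : ln (1 + a ^+ 2) * (eps * x) <= ln (1 + a ^+ 2) * expR (eps * x).
  by rewrite ler_pM2l// (le_trans _ (expR_ge1Dx _))//; lra.
lra.
Qed.

End asymptotics.

(** * Application to the three excessive-bias sets *)

Section perturbations.
Context {R : realType}.

(** Spikes of height sqrt(eps log n) are hidden in two ways. In the first two sets they stay within
    the energy budget, because [b * m n / (8 * c)] equals [C2 / 8] or [D2 / 8], a constant free of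
    [n]. In the third the threshold factor [m n] vanishes, so they lie above the threshold. *)
Lemma undetectable_perturbations (A C2 D2 L eps a : R) (m : nat -> R)
    (Theta0 : forall n, set (n.-tuple R)) :
  1 < A -> 0 < C2 -> 0 < D2 -> 0 < L -> 0 < eps < 1 / 2 -> 0 < a ->
  (forall n, 0 < m n) -> m n @[n --> \oo] --> (0 : R) ->
  [\/ Theta0 = excessive_bias1 A C2 m (s2 eps),
      Theta0 = excessive_bias2 A D2 m (s2 eps) |
      Theta0 = excessive_bias3 C2 D2 m (s2 eps)] ->
  exists N, forall n, (N <= n)%N ->
  Theta0 n `&` @sparse R n (s1 m eps n) !=set0 ->
  exists (theta : n.-tuple R) (F : finType) (w : F -> n.-tuple R),
    [/\ (Theta0 n `&` sparse (s1 m eps n)) theta,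
        forall f, (Theta0 n `&` sparse (s2 eps n)) (observation theta (w f)),
        (0 < #|F|)%N,
        \sum_f \sum_g expR (dotp (w f) (w g)) <= (1 + a ^+ 2) * #|F|%:R ^+ 2 &
        forall f, L * s1 m eps n * ln (n%:R / s1 m eps n) <
                  sqdist theta (observation theta (w f))].
Proof.
move=> A1 C20 D20 L0 e a0 m0 mcvg Theta0E.
have [e0 e12] := andP e.
pose kp : R := Num.min (1 / 2) (Num.min C2 D2 / 8).
have kp0 : 0 < kp.
  by rewrite lt_min divr_gt0//= divr_gt0// lt_min C20 D20.
have kp12 : kp <= 1 / 2 by rewrite ge_min lexx.
have kpC : kp <= C2 / 8.
  by rewrite ge_min; apply/orP; right; rewrite ler_pM2r// ge_min lexx.
have kpD : kp <= D2 / 8.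
  by rewrite ge_min; apply/orP; right; rewrite ler_pM2r// ge_min lexx orbT.
have [X [mu [mu0 cal]]] := calibration e L0 kp0 a0.
have [N1 hN1] := ln_nat_ge X.
(* The bound by [eps] yields [m n <= 1 / 2] and [2 * m n ^+ 2 <= eps], the latter for the third set;
   [C2^-1] is the value of [c] in the first and third sets. *)
pose mu' := Num.min mu (Num.min eps C2^-1).
have mu'0 : 0 < mu' by rewrite !lt_min mu0 e0 invr_gt0.
have [N2 _ hN2] := cvgr_le _ mcvg _ mu'0.
exists (maxn N1 N2) => n; rewrite geq_max => /andP[nN1 nN2].
have {hN2} : m n <= mu' by exact: hN2.
rewrite !le_min => /and3P[mmu me mC].
have mn0 := m0 n.
have [|ln1 sn lns kps [sep chi]] := cal n (m n) (hN1 _ nN1); first by rewrite mn0.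
have s0 : 0 < s2 eps n by rewrite -(pmulr_rgt0 _ kp0); lra.
have dE : Num.sqrt (eps * ln n%:R) ^+ 2 = eps * ln n%:R :> R.
  by rewrite sqr_sqrtr// mulr_ge0; lra.
have ln0' : 0 <= ln (n%:R : R) by lra.
have m12 : m n <= 1 / 2 by lra.
have main kappa b c : 0 < c -> 0 < kappa -> 0 <= b -> m n <= c ->
    kappa * Num.sqrt (2 * ln (n%:R : R)) <= Num.sqrt (eps * ln n%:R) \/
    kp <= b * m n / (8 * c) ->
  excessive_bias (s2 eps n) kappa b c `&` @sparse R n (s1 m eps n) !=set0 ->
  exists (theta : n.-tuple R) (F : finType) (w : F -> n.-tuple R),
    [/\ (excessive_bias (s2 eps n) kappa b c `&` sparse (s1 m eps n)) theta,
        forall f, (excessive_bias (s2 eps n) kappa b c `&` sparse (s2 eps n))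
          (observation theta (w f)),
        (0 < #|F|)%N,
        \sum_f \sum_g expR (dotp (w f) (w g)) <= (1 + a ^+ 2) * #|F|%:R ^+ 2 &
        forall f, L * s1 m eps n * ln (n%:R / s1 m eps n) <
                  sqdist theta (observation theta (w f))].
  move=> c0 kappa0 b0 mc cases ne.
  apply: (@least_favorable _ n (s2 eps n) (m n) kappa b c kp
    (Num.sqrt (eps * ln n%:R)) L a) => //.
  case: cases => [?|kpb]; [by left|right].
  rewrite dE (_ : _ / (4 * c) * _ = m n / (8 * c) * (s2 eps n * ln n%:R)).
    2: by field; rewrite gt_eqF.
  rewrite (mulrA b) (mulrA b).
  have sl : 0 <= s2 eps n * ln n%:R by rewrite mulr_ge0// ltW.
  apply: (@le_trans _ _ (kp * (s2 eps n * ln n%:R))).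
    rewrite -[X in X <= _]mulrA ler_pM2l// ler_pM2l// ler_piMl//; lra.
  by rewrite ler_wpM2r.
case: Theta0E => -> ne; rewrite /excessive_bias1 /excessive_bias2 /excessive_bias3 in ne *.
- apply: main => //.
  + by rewrite invr_gt0.
  + lra.
  + by rewrite invr_ge0 ltW.
  + by right; rewrite mulVf ?gt_eqF// invfM invrK mul1r mulrC.
- apply: main => //; first lra.
  + exact: ltW.
  + right; rewrite [leRHS](_ : _ = D2 / 8)//; field; rewrite gt_eqF//.
- apply: main => //.
  + by rewrite invr_gt0.
  + exact: ltW.
  + left; rewrite -ler_sqr ?nnegrE ?sqrtr_ge0//.
    2: by rewrite mulr_ge0 ?sqrtr_ge0// ltW.
    rewrite exprMn dE sqr_sqrtr ?mulr_ge0// mulrA ler_wpM2r//.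
    have : m n * m n <= eps * (1 / 2) by rewrite ler_pM// ltW.
    rewrite -expr2; lra.
Qed.

End perturbations.

(** * Contradiction between coverage and diameter at the two sparsity levels *)

Theorem theorem4 (R : realType) (A C2 D2 L eps : R) (m : nat -> R)
    (Theta0 : forall n : nat, set (n.-tuple R))
    (hA : 1 < A) (hC2 : 0 < C2) (hD2 : 0 < D2) (hL : 0 < L)
    (heps : 0 < eps < 1 / 2)
    (m_gt0 : forall n, 0 < m n) (m_cvg0 : m n @[n --> \oo] --> (0 : R))
    (hTheta0 : [\/ Theta0 = excessive_bias1 A C2 m (s2 eps),
                   Theta0 = excessive_bias2 A D2 m (s2 eps)
                 | Theta0 = excessive_bias3 C2 D2 m (s2 eps)])
    (* m tends to 0 slowly enough for the classes of sparsity s1 not to be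
       eventually empty *)
    (m_slow : forall N : nat, exists n : nat,
       (N <= n)%N /\ Theta0 n `&` @sparse R n (s1 m eps n) !=set0) :
  ~ exists (beta beta' : R) (C : forall n, n.-tuple R -> set (n.-tuple R)),
      [/\ 0 < beta < 1 / 3, 0 < beta' < 1 / 3,
          (forall n, confidence_set (C n))
        & forall s : nat -> R, s = s1 m eps \/ s = s2 eps ->
            ((1 - beta)%:E <= limn_einf (fun n => ereal_inf
               [set law theta [set x | C n x theta]
                 | theta in Theta0 n `&` sparse (s n)]))%E /\
            ((1 - beta')%:E <= limn_einf (fun n => ereal_inf
               [set law theta
                      [set x | sqdiam (C n x) <= (L * s n * ln (n%:R / s n))%:E]
                 | theta in Theta0 n `&` sparse (s n)]))%E].
Proof.
move=> [beta [beta' [C [/andP[b0 b13] /andP[b'0 b'13] hC hs]]]].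
(* The argument spends [4 * a]: one for each of the two coverage bounds, one for the diameter bound
   and one for the mixture. A fifth [a] makes the contradiction strict. *)
pose a : R := (1 - 2 * beta - beta') / 5.
have a0 : 0 < a by rewrite divr_gt0//; lra.
have [N hN] := undetectable_perturbations hA hC2 hD2 hL heps a0 m_gt0 m_cvg0 hTheta0.
have ba : 1 - (beta + a) < 1 - beta by lra.
have b'a : 1 - (beta' + a) < 1 - beta' by lra.
have [cov1 diam1] := hs _ (or_introl erefl).
have [cov2 _] := hs _ (or_intror erefl).
have [N1 hN1] := limn_einf_near cov1 ba.
have [N2 hN2] := limn_einf_near diam1 b'a.
have [N3 hN3] := limn_einf_near cov2 ba.
(* A single [n] beyond all four thresholds at which the class of sparsity [s1] is inhabited. *)
have [n [nN ne]] := m_slow (maxn N (maxn N1 (maxn N2 N3))).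
move: nN; rewrite !geq_max => /and4P[nN nN1 nN2 nN3].
have [theta [F [w [th thw F0 H2 sep]]]] := hN n nN ne.
suff : 1 <= 2 * (beta + a) + (beta' + a) + a.
  have : 5 * a = 1 - 2 * beta - beta' by rewrite mulrC divfK.
  lra.
apply: (confidence_set_tradeoff (hC n) a0 F0 H2 sep).
- by apply: (le_trans (hN1 n nN1)); apply: ereal_inf_lbound; exists theta.
- by apply: (le_trans (hN2 n nN2)); apply: ereal_inf_lbound; exists theta.
- move=> f; apply: (le_trans (hN3 n nN3)); apply: ereal_inf_lbound.
  by exists (observation theta (w f)).
Qed.
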